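(* Let $S_n:=X_1+\cdots+X_n$, where $X_1,\dots,X_n$ are independent zero-mean sub-exponential real-valued random variables. Let $$B_{n,1}^2:=\sum_{i=1}^n\|X_i\|_{\psi_{11}}^2\quad\text{and}\quad M_{n,1}:=\max_{1\le i\le n}\|X_i\|_{\psi_{11}},$$ and suppose that $M_{n,1}\in(0,\infty)$ (equivalently, $B_{n,1}^2\in(0,\infty)$). Then for all real $x\ge0$ $$\mathsf P(S_n\ge x)\le U(x;B_{n,1}^2,M_{n,1})\le\exp\Big(-\min\Big(\frac{x^2}{4B_{n,1}^2},\frac{x}{2M_{n,1}}\Big)\Big),$$ where, for real $b>0$ and $m>0$, $$U(x;b,m):=\begin{cases}\exp\Big(-\dfrac{x^2}{4b}\Big)&\text{if } x\le \dfrac{2b}{m},\\[2mm] \exp\Big(-\Big(\dfrac{x}{m}-\dfrac{b}{m^2}\Big)\Big)&\text{if } x\ge\dfrac{2b}{m}.\end{cases}$$ Moreover, in these inequalities $B_{n,1}^2$ and $M_{n,1}$ can be replaced by the larger quantities $$B_n^2:=\sum_{i=1}^n\|X_i\|_{\psi_1}^2\quad\text{and}\quad M_n:=\max_{1\le i\le n}\|X_i\|_{\psi_1},$$ respectively; that is, for all real $x\ge0$, $$\mathsf P(S_n\ge x)\le U(x;B_n^2,M_n)\le\exp\Big(-\min\Big(\frac{x^2}{4B_n^2},\frac{x}{2M_n}\Big)\Big),$$ and these upper bounds are no better than the corresponding ones above, i.e. $U(x;B_{n,1}^2,M_{n,1})\le U(x;B_n^2,M_n)$ and $\exp(-\min(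\frac{x^2}{4B_{n,1}^2},\frac{x}{2M_{n,1}}))\le\exp(-\min(\frac{x^2}{4B_n^2},\frac{x}{2M_n}))$.
   Context: For $u\in[0,\infty)$, let $\psi_1(u):=e^u-1$ and $\psi_{11}(u):=e^u-1-u$. For $f\in\{\psi_1,\psi_{11}\}$ and a real-valued random variable $X$, let $\|X\|_f:=\inf\{x>0\colon\mathsf E f(|X|/x)\le1\}$, with $\inf\emptyset:=\infty$. A random variable $X$ is called sub-exponential if $\|X\|_{\psi_1}<\infty$ (light tails). One has $\|X\|_{\psi_{11}}\le\|X\|_{\psi_1}$ for every $X$. *)

(* Defs.v *)
From HB Require Import structures.
From mathcomp Require Import all_boot all_order all_algebra.
From mathcomp Require Import all_classical all_reals all_analysis.
From mathcomp Require Import ring lra.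

Set Implicit Arguments.
Unset Strict Implicit.
Unset Printing Implicit Defensive.

Import Order.TTheory GRing.Theory Num.Theory.
Import numFieldNormedType.Exports.

Local Open Scope classical_set_scope.
Local Open Scope ring_scope.

(* psi1 and psi11 are only evaluated at nonnegative arguments. *)
Definition psi1 (R : realType) (u : R) : R := expR u - 1.

Definition psi11 (R : realType) (u : R) : R := expR u - 1 - u.

(* The infimum is taken in \bar R, so that the infimum of the empty set
   is +oo. *)
Definition psi_norm d (T : measurableType d) (R : realType)
    (P : probability T R) (f : R -> R) (X : T -> R) : \bar R :=
  ereal_inf [set x%:E | x in
    [set x : R | 0 < x /\ ('E_P[fun w => f (`|X w| / x)%R] <= 1)%E]].

Definition sub_exponential d (T : measurableType d) (R : realType)
    (P : probability T R) (X : T -> R) : Prop :=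
  (psi_norm P (@psi1 R) X < +oo)%E.

Definition mutually_independent d d' (T : measurableType d)
    (T' : measurableType d') (R : realType) (P : probability T R)
    (I : finType) (X : I -> {RV P >-> T'}) : Prop :=
  forall (J : {set I}) (A : I -> set T'),
    (forall i, i \in J -> measurable (A i)) ->
    P (\bigcap_(i in [set` J]) (X i @^-1` A i)) =
    (\prod_(i in J) P (X i @^-1` A i))%E.

Arguments mutually_independent {d d' T T' R} P {I} X.

Section family.
Context d (T : measurableType d) (R : realType) (P : probability T R).
Context (f : R -> R) (n : nat) (X : 'I_n -> T -> R).
Local Open Scope ereal_scope.

Definition sum_sqr_norm : \bar R := \sum_(i < n) (psi_norm P f (X i)) ^+ 2.

(* The initial value -oo is the least element of \bar R, so for n > 0 this is
   the maximum of the n norms. *)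
Definition max_norm : \bar R := \big[maxe/-oo]_(i < n) psi_norm P f (X i).

End family.

(* The two cases of the definition overlap at x = 2 b / m, where they agree:
   see boundU_ge. *)
Definition boundU (R : realType) (x b m : R) : R :=
  if x <= 2 * b / m then expR (- (x ^+ 2 / (4 * b)))
  else expR (- (x / m - b / m ^+ 2)).

Lemma boundU_ge (R : realType) (x b m : R) : 0 < b -> 0 < m ->
  2 * b / m <= x -> boundU x b m = expR (- (x / m - b / m ^+ 2)).
Proof.
move=> b0 m0 hx; rewrite /boundU; case: ifPn => // xle.
have -> : x = 2 * b / m by apply/eqP; rewrite eq_le xle hx.
by congr (expR (- _)); field; rewrite !gt_eqF.
Qed.

Definition bound_min (R : realType) (x b m : R) : R :=
  expR (- Num.min (x ^+ 2 / (4 * b)) (x / (2 * m))).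

(* Main.v *)
Require Import Defs.
From HB Require Import structures.
From mathcomp Require Import all_boot all_order all_algebra.
From mathcomp Require Import all_classical all_reals all_analysis.
From mathcomp Require Import measurable_realfun.
From mathcomp Require Import ring lra.

(** The proof is the Chernoff method, organised around the description of the
    bound U as a constrained minimum: for x >= 0, boundU x b m is the least
    value of exp (t^2 b - t x) over 0 <= t <= 1 / m.

    Let a be the psi11-norm of a centred variable X. For c > a and t c <= 1,
    comparing power series gives psi11 (t X) <= (t c)^2 psi11 (|X| / c)
    (psi11_scale_le). Since X has mean zero, E exp (t X) = 1 + E psi11 (t X),
    which is at most 1 + (t c)^2 <= exp (t^2 c^2) (expectation_expR_le); letting
    c decrease to a yields E exp (t X) <= exp (t^2 a^2) for t a < 1 (mgf_le).
    Independence turns the moment generating function of the sum into a product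
    (expectation_prod_independent), so that for t M < 1 Markov's inequality
    bounds the tail by exp (t^2 B - t x), and by continuity this also holds for
    t = 1 / M (tail_le). Choosing the minimising t gives U (boundU_attained).

    The comparison of the values of U for the two norms also follows from the
    minimum: the psi1-norms dominate the psi11-norms because psi11 <= psi1 on
    nonnegative reals, and a minimum increases when its objective increases or
    its domain shrinks (le_boundU). *)

Set Implicit Arguments.
Unset Strict Implicit.
Unset Printing Implicit Defensive.

Import Order.TTheory GRing.Theory Num.Theory.
Import numFieldNormedType.Exports.

Local Open Scope classical_set_scope.
Local Open Scope ring_scope.

(** * The functions psi1 and psi11 *)

Section psi11_theory.
Context {R : realType}.
Implicit Types u v c t C : R.

(** Termwise comparison, psi11 u being the sum of u ^ k / k! over k >= 2. In
    this form it also covers negative u, compared with v = |u|. *)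
Lemma psi11_le_power u v C :
  (forall k, u ^+ k.+2 <= C * v ^+ k.+2) -> psi11 u <= C * psi11 v.
Proof.
move=> uv.
(* The exponential series without its first two terms, which sum to 1 + w. *)
pose s (w : R) : nat -> R := fun n => \sum_(0 <= k < n) (w ^+ k.+2 / k.+2`!%:R).
have scvg w : s w @ \oo --> psi11 w.
  have sE : (fun n => s w n + (1 + w)) @ \oo --> expR w.
    have -> : (fun n => s w n + (1 + w)) =
              [sequence series (exp_coeff w) (n + 2)%N]_n.
      apply/funext => n; rewrite /= /series /= addn2 !big_nat_recl//.
      by rewrite /exp_coeff /= /s expr0 expr1 fact0 !divr1 addrC addrA.
    by rewrite cvg_shiftn; exact: is_cvg_series_exp_coeff.
  have -> : s w = (fun n => s w n + (1 + w)) \- cst (1 + w).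
    by apply/funext => n /=; rewrite addrK.
  rewrite /psi11 -addrA -opprD; apply: cvgB; [exact: sE|exact: cvg_cst].
have Cv : (fun n => C * s v n) @ \oo --> C * psi11 v.
  by apply: cvgM; [exact: cvg_cst|exact: scvg].
apply: (ler_cvg_to (scvg u) Cv); apply: nearW => n.
rewrite /s mulr_sumr; apply: ler_sum => k _.
by rewrite mulrA ler_wpM2r.
Qed.

(** In each term t u = (t c) (u / c), and (t c) ^ k <= (t c) ^ 2 for k >= 2:
    only the lowest power of t survives, which is where the quadratic exponent
    of the moment generating function comes from. *)
Lemma psi11_scale_le t c u : 0 <= t -> 0 < c -> t * c <= 1 ->
  psi11 (t * u) <= (t * c) ^+ 2 * psi11 (`|u| / c).
Proof.
move=> t0 c0 tc; apply: psi11_le_power => k.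
have -> : t * u = (t * c) * (u / c) by field; rewrite gt_eqF.
have tc0 : 0 <= t * c by rewrite mulr_ge0// ltW.
rewrite exprMn (le_trans (ler_norm _))// normrM !normrX (ger0_norm tc0).
rewrite normrM (@ger0_norm _ c^-1) ?invr_ge0 ?(ltW c0)//.
rewrite ler_wpM2r ?exprn_ge0 ?mulr_ge0 ?invr_ge0 ?(ltW c0)//.
by rewrite -addn2 exprD ler_piMl ?exprn_ge0// exprn_ile1.
Qed.

Lemma psi11_ge0 u : 0 <= psi11 u.
Proof. by rewrite /psi11 -addrA -opprD subr_ge0 expR_ge1Dx. Qed.

Lemma le_psi11 u v : 0 <= u -> u <= v -> psi11 u <= psi11 v.
Proof.
move=> u0 uv; rewrite -[psi11 v]mul1r; apply: psi11_le_power => k.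
by rewrite mul1r lerXn2r// nnegrE// (le_trans u0).
Qed.

Lemma psi11_le_psi1 u : 0 <= u -> psi11 u <= psi1 u.
Proof. by move=> u0; rewrite /psi11 /psi1 gerBl. Qed.

Lemma psi1_ge u : u <= psi1 u.
Proof. by rewrite /psi1 lerBrDl expR_ge1Dx. Qed.

Lemma measurable_psi11 : measurable_fun setT (@psi11 R).
Proof. by apply: measurable_funB => //; apply: measurable_funB. Qed.

Lemma measurable_psi1 : measurable_fun setT (@psi1 R).
Proof. exact: measurable_funB. Qed.

End psi11_theory.

(** * The bound U as a constrained minimum *)

(** For x >= 0, the exponent t ^ 2 b - t x is a convex parabola in t, minimal at
    t = x / (2 b). Over 0 <= t <= 1 / m its minimum is at that vertex when
    x <= 2 b / m, and at the end point 1 / m otherwise: these are the two cases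
    of boundU. The constraint is written t m <= 1 below. *)
Section boundU_theory.
Context {R : realType}.
Implicit Types x b m t : R.

Lemma boundU_le_expR x b m t : 0 < b -> 0 < m -> 0 <= t -> t * m <= 1 ->
  boundU x b m <= expR (t ^+ 2 * b - t * x).
Proof.
move=> b0 m0 t0 tm; rewrite /boundU; case: ifPn => [_|].
  rewrite ler_expR lerNl opprB lerBlDr -subr_ge0.
  have -> : x ^+ 2 / (4 * b) + t ^+ 2 * b - t * x =
            (x - 2 * t * b) ^+ 2 / (4 * b) by field; rewrite gt_eqF.
  by rewrite divr_ge0 ?sqr_ge0// mulr_ge0// ltW.
rewrite -ltNge => xm; rewrite ler_expR lerNl opprB -subr_ge0.
have -> : x / m - b / m ^+ 2 - (t * x - t ^+ 2 * b) =
   (1 - t * m) / m * ((x - 2 * b / m) + (1 - t * m) * b / m).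
  by field; rewrite gt_eqF.
have tm' : 0 <= 1 - t * m by rewrite subr_ge0.
apply: mulr_ge0; first by rewrite divr_ge0// ltW.
by rewrite addr_ge0 ?subr_ge0 ?(ltW xm)// divr_ge0 ?mulr_ge0// ltW.
Qed.

Lemma boundU_attained x b m : 0 < b -> 0 < m -> 0 <= x ->
  exists t, [/\ 0 <= t, t * m <= 1 & boundU x b m = expR (t ^+ 2 * b - t * x)].
Proof.
move=> b0 m0 x0; rewrite /boundU; case: ifPn => [xm|_].
  exists (x / (2 * b)); split; first by rewrite divr_ge0// mulr_ge0// ltW.
    by rewrite mulrAC ler_pdivrMr ?mulr_gt0// mul1r -ler_pdivlMr.
  by congr expR; field; rewrite gt_eqF.
exists m^-1; split; first by rewrite invr_ge0 ltW.
  by rewrite mulVf// gt_eqF.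
by congr expR; field; rewrite gt_eqF.
Qed.

(** Increasing b raises the objective t ^ 2 b - t x and increasing m shrinks the
    set of admissible t; either way the minimum goes up. *)
Lemma le_boundU x b b' m m' : 0 < b -> 0 < m -> 0 <= x -> b <= b' -> m <= m' ->
  boundU x b m <= boundU x b' m'.
Proof.
move=> b0 m0 x0 bb' mm'.
have [t [t0 tm ->]] : exists t, [/\ 0 <= t, t * m' <= 1 &
    boundU x b' m' = expR (t ^+ 2 * b' - t * x)].
  by apply: boundU_attained => //; [exact: lt_le_trans bb'|exact: lt_le_trans mm'].
apply: (le_trans (@boundU_le_expR x b m t b0 m0 t0 _)).
  by rewrite (le_trans _ tm)// ler_wpM2l.
by rewrite ler_expR lerD2r ler_wpM2l// sqr_ge0.
Qed.

(** Beyond 2 b / m, one has b / m ^ 2 < x / (2 m), so that the linear exponent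
    x / m - b / m ^ 2 keeps at least half of x / m. *)
Lemma boundU_le_min x b m : 0 < b -> 0 < m -> boundU x b m <= bound_min x b m.
Proof.
move=> b0 m0; rewrite /boundU /bound_min; case: ifPn => [_|].
  by rewrite ler_expR lerN2 ge_min lexx.
rewrite -ltNge => xm; rewrite ler_expR lerN2 ge_min; apply/orP; right.
rewrite -subr_ge0.
have -> : x / m - b / m ^+ 2 - x / (2 * m) = (x - 2 * b / m) / (2 * m).
  by field; rewrite gt_eqF.
by rewrite divr_ge0 ?subr_ge0 ?(ltW xm)// mulr_ge0// ltW.
Qed.

Lemma le_bound_min x b b' m m' : 0 < b -> 0 < m -> 0 <= x -> b <= b' -> m <= m' ->
  bound_min x b m <= bound_min x b' m'.
Proof.
move=> b0 m0 x0 bb' mm'; rewrite /bound_min ler_expR lerN2.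
have b0' := lt_le_trans b0 bb'; have m0' := lt_le_trans m0 mm'.
rewrite le_min !ge_min; apply/andP; split; apply/orP; [left|right].
  by rewrite ler_wpM2l ?sqr_ge0// lef_pV2 ?posrE ?mulr_gt0// ler_pM2l.
by rewrite ler_wpM2l// lef_pV2 ?posrE ?mulr_gt0// ler_pM2l.
Qed.

End boundU_theory.

(** * Products of functions of independent variables *)

Section independence.
Context d d' (T : measurableType d) (T' : measurableType d') (R : realType).
Variable P : probability T R.

Import HBNNSimple.

(** The hypothesis says that the law of Y under the weight G is c times its law
    under P. Equality of the integrals of f passes from indicators to simple
    functions by linearity, and to f by monotone convergence. *)
Lemma expectation_weighted (Y : {RV P >-> T'}) (G : T -> R) (c : R) (f : T' -> R) :
  measurable_fun setT G -> (forall w, 0 <= G w) -> 0 <= c ->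
  (forall A, measurable A ->
    ('E_P[fun w => (G w * \1_A (Y w))%R] = c%:E * P (Y @^-1` A))%E) ->
  measurable_fun setT f -> (forall y, 0 <= f y) ->
  ('E_P[fun w => (G w * f (Y w))%R] = c%:E * 'E_P[fun w => f (Y w)])%E.
Proof.
move=> mG G0 c0 GA mf f0; rewrite unlock.
have mfE : measurable_fun setT (EFin \o f : T' -> \bar R) by exact/measurable_EFinP.
pose f_ := nnsfun_approx measurableT mfE.
have mfY n : measurable_fun setT (fun w => f_ n (Y w)).
  by apply: measurableT_comp.
have f_cvg y : (f_ n y)%:E @[n --> \oo] --> (f y)%:E.
  by apply: (@cvg_nnsfun_approx _ _ _ _ measurableT _ mfE) => // z _; rewrite lee_fin.
have f_nd y m n : (m <= n)%N -> f_ m y <= f_ n y.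
  by move=> mn; exact/lefP/nd_nnsfun_approx.
have simple n : (\int[P]_w (G w * f_ n (Y w))%:E =
                 c%:E * \int[P]_w (f_ n (Y w))%:E)%E.
  have mI k : measurable (f_ n @^-1` [set k]) by [].
  have mIY k : measurable (Y @^-1` (f_ n @^-1` [set k])).
    by rewrite -[X in measurable X]setTI; exact: measurable_funP.
  have mIf k : measurable_fun setT (fun w => \1_(f_ n @^-1` [set k]) (Y w) : R).
    by apply: measurableT_comp.
  transitivity (\int[P]_w \sum_(k \in range (f_ n))
      (k * (G w * \1_(f_ n @^-1` [set k]) (Y w)))%:E)%E.
    apply: eq_integral => w _; rewrite fsumEFin// fimfunE; congr EFin.
    rewrite !fsbig_finite//= mulr_sumr; apply: eq_bigr => k _.
    by rewrite mulrCA.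
  transitivity (c%:E * \int[P]_w \sum_(k \in range (f_ n))
      (k * \1_(f_ n @^-1` [set k]) (Y w))%:E)%E; last first.
    by congr (_ * _)%E; apply: eq_integral => w _; rewrite fsumEFin// fimfunE.
  have k0 k w : 0 <= k * \1_(f_ n @^-1` [set k]) (Y w) :> R.
    rewrite indicE; case: (boolP (_ \in _)) => [/[!inE]/= <-|_].
      by rewrite mulr1.
    by rewrite mulr0.
  rewrite !ge0_integral_fsum//.
  - rewrite ge0_mule_fsumr; last by move=> k; apply: integral_ge0 => w _; rewrite lee_fin.
    apply: eq_fsbigr => k /[!inE] -[y _ <-{k}].
    have y0 : 0 <= f_ n y by [].
    under eq_integral do rewrite EFinM.
    under [in RHS]eq_integral do rewrite EFinM.
    rewrite !ge0_integralZl_EFin//.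
    + have := GA _ (mI (f_ n y)); rewrite unlock => ->.
      rewrite muleCA; congr (_ * (_ * _))%E.
      by rewrite -[in LHS](setIT (Y @^-1` _)) -integral_indic.
    + exact: (measurable_EFinP _ _).2.
    + by move=> w _; rewrite lee_fin mulr_ge0.
    + apply/measurable_EFinP; exact: measurable_funM.
  - move=> k; apply/measurable_EFinP; exact: measurable_funM.
  - by move=> k w _; rewrite lee_fin.
  - move=> k; apply/measurable_EFinP; apply: measurable_funM => //.
    exact: measurable_funM.
  - by move=> k w _; rewrite lee_fin mulrCA mulr_ge0.
have L : (\int[P]_w (G w * f_ n (Y w))%:E)%E @[n --> \oo] -->
         (\int[P]_w (G w * f (Y w))%:E)%E.
  apply: cvg_trans.
    apply: (@cvg_monotone_convergence _ _ _ P setT measurableT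
      (fun n w => (G w * f_ n (Y w))%:E)).
    + by move=> n; apply/measurable_EFinP; exact: measurable_funM.
    + by move=> n w _; rewrite lee_fin mulr_ge0.
    + by move=> w _ m n mn; rewrite lee_fin ler_wpM2l// f_nd.
  rewrite (_ : (\int[P]_x limn _)%E = (\int[P]_w (G w * f (Y w))%:E)%E)//.
  apply: eq_integral => w _; apply/cvg_lim => //.
  under eq_fun do rewrite EFinM.
  by rewrite EFinM; apply: cvgeZl.
have L' : (\int[P]_w (f_ n (Y w))%:E)%E @[n --> \oo] -->
         (\int[P]_w (f (Y w))%:E)%E.
  apply: cvg_trans.
    apply: (@cvg_monotone_convergence _ _ _ P setT measurableT
      (fun n w => (f_ n (Y w))%:E)).
    + by move=> n; apply/measurable_EFinP.
    + by move=> n w _; rewrite lee_fin.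
    + by move=> w _ m n mn; rewrite lee_fin f_nd.
  rewrite (_ : (\int[P]_x limn _)%E = (\int[P]_w (f (Y w))%:E)%E)//.
  by apply: eq_integral => w _; apply/cvg_lim.
have : (c%:E * \int[P]_w (f_ n (Y w))%:E)%E @[n --> \oo] -->
         (c%:E * \int[P]_w (f (Y w))%:E)%E by exact: cvgeZl.
under eq_fun do rewrite -simple.
by move=> L''; exact: (cvg_unique _ L L'').
Qed.

(** The product rule is known when every f i is an indicator: this is the
    definition of independence. The indicators are then traded for the actual
    functions one index at a time: if the rule holds whenever the factor at j is
    an indicator, then expectation_weighted, with the other factors as weight,
    extends it to an arbitrary factor at j. *)
Lemma expectation_prod_independent (I : finType) (X : I -> {RV P >-> T'})
    (f : I -> T' -> R) :
  mutually_independent P X ->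
  (forall i, measurable_fun setT (f i)) -> (forall i y, 0 <= f i y) ->
  (forall i, ('E_P[fun w => f i (X i w)] < +oo)%E) ->
  ('E_P[fun w => (\prod_i f i (X i w))%R] = \prod_i 'E_P[fun w => f i (X i w)])%E.
Proof.
move=> Xindep.
(* s lists the indices whose factor is not required to be an indicator. *)
suff H (s : seq I) (g : I -> T' -> R) :
  (forall i, measurable_fun setT (g i)) -> (forall i y, 0 <= g i y) ->
  (forall i, ('E_P[fun w => g i (X i w)] < +oo)%E) ->
  (forall i, i \notin s -> exists2 A, measurable A & g i = \1_A) ->
  ('E_P[fun w => (\prod_i g i (X i w))%R] = \prod_i 'E_P[fun w => g i (X i w)])%E.
  move=> mf f0 foo; apply: (H (enum I)) => // i; by rewrite mem_enum.
elim: s g => [|j s IH] g mg g0 goo gind.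
  have {}gind i : exists A, measurable A /\ g i = \1_A.
    by have [A mA ->] := gind i erefl; exists A.
  have /choice[A mgA] := gind.
  have mA i : measurable (A i) by have [] := mgA i.
  have mXA i : measurable (X i @^-1` A i).
    by rewrite -[X in measurable X]setTI; exact: measurable_funP.
  have E i : ('E_P[fun w => g i (X i w)] = P (X i @^-1` A i))%E.
    by rewrite -expectation_indic//; have [_ ->] := mgA i.
  rewrite (eq_bigr _ (fun i _ => E i)).
  have := Xindep [set: I]%SET A (fun i _ => mA i).
  rewrite [in X in _ = X -> _](eq_bigl xpredT); last by move=> i; rewrite inE.
  move=> <-; rewrite -expectation_indic; last first.
    exact: fin_bigcap_measurable.
  congr expectation; apply/funext => w.
  under eq_bigr => i _ do have [_ ->] := mgA i.
  have [wA|/existsNP[i]] := pselect (forall i, A i (X i w)).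
    rewrite big1; last by move=> i _; rewrite indicE mem_set.
    by rewrite indicE mem_set// => i _; exact: wA.
  move=> wA; rewrite (bigD1 i)//= indicE memNset// mul0r indicE memNset//.
  by move=> /(_ i); rewrite /= inE => /(_ isT).
pose G w := \prod_(i | i != j) g i (X i w).
pose c := \prod_(i | i != j) fine ('E_P[fun w => g i (X i w)])%E.
have E0 i : (0 <= 'E_P[fun w => g i (X i w)])%E by apply: expectation_ge0.
have Efin i : ('E_P[fun w => g i (X i w)])%E \is a fin_num by rewrite ge0_fin_numE.
have cE : (c%:E = \prod_(i | i != j) 'E_P[fun w => g i (X i w)])%E.
  rewrite /c -prodEFin; apply: eq_bigr => i _; by rewrite fineK.
rewrite (bigD1 j)//= muleC -cE.
under eq_fun do rewrite (bigD1 j)//= mulrC.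
apply: (@expectation_weighted (X j) G c (g j)) => //.
- rewrite /G; under eq_fun do rewrite -big_filter.
  by apply: measurable_prod => i _; exact: measurableT_comp.
- by move=> w; apply: prodr_ge0.
- by apply: prodr_ge0 => i _; apply: fine_ge0.
move=> A mA.
pose h i := if i == j then \1_A else g i.
have hj : h j = \1_A by rewrite /h eqxx.
have hN i : i != j -> h i = g i by rewrite /h => /negbTE ->.
have mXA : measurable (X j @^-1` A).
  by rewrite -[X in measurable X]setTI; exact: measurable_funP.
have : ('E_P[fun w => (\prod_i h i (X i w))%R] =
        \prod_i 'E_P[fun w => h i (X i w)])%E.
  apply: IH => i.
  - by rewrite /h; case: ifPn.
  - by move=> y; rewrite /h; case: ifPn.
  - rewrite /h; case: ifPn => // /eqP ->.
    rewrite (_ : (fun w => _) = \1_(X j @^-1` A))// expectation_indic//.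
    by rewrite (le_lt_trans (probability_le1 _ _))// ltry.
  - move=> si; rewrite /h; case: ifPn => [_|ij]; first by exists A.
    by apply: gind; rewrite inE negb_or ij.
rewrite (bigD1 j)//= hj.
under eq_fun do rewrite (bigD1 j)//= hj mulrC.
under eq_fun do under eq_bigr => i ij do rewrite hN//.
under [in X in _ = X -> _]eq_bigr => i ij do rewrite hN//.
by move=> ->; rewrite muleC cE -expectation_indic.
Qed.

End independence.

(** * Orlicz norms and moment generating functions *)

Section mgf.
Context d (T : measurableType d) (R : realType) (P : probability T R).
Implicit Types (X : {RV P >-> R}) (f : R -> R) (t c : R).

Lemma psi_norm_ge0 f (X : T -> R) : (0 <= psi_norm P f X)%E.
Proof. by apply: le_ereal_inf_tmp => _ [x [x0 _] <-]; rewrite lee_fin ltW. Qed.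

Lemma ge0_expectation_le (Y Z : T -> R) :
  measurable_fun setT Y -> measurable_fun setT Z ->
  (forall w, 0 <= Y w) -> (forall w, Y w <= Z w) -> ('E_P[Y] <= 'E_P[Z])%E.
Proof.
move=> mY mZ Y0 YZ; apply: expectation_le => //.
- by move=> w; rewrite (le_trans (Y0 w)).
- exact: aeW.
Qed.

Lemma measurable_psi_scaled f X x : measurable_fun setT f ->
  measurable_fun setT (fun w => f (`|X w| / x)).
Proof.
move=> mf; apply: measurableT_comp => //.
apply: measurable_funM => //; exact: measurableT_comp.
Qed.

Lemma psi11_norm_le_psi1_norm X :
  (psi_norm P (@psi11 R) X <= psi_norm P (@psi1 R) X)%E.
Proof.
apply: ereal_inf_le_tmp => _ [x [x0 Ex] <-]; exists x => //; split=> //.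
have u0 w : 0 <= `|X w| / x by rewrite divr_ge0// ltW.
apply: le_trans Ex; apply: ge0_expectation_le => [||w|w].
- by apply: measurable_psi_scaled; exact: measurable_psi11.
- by apply: measurable_psi_scaled; exact: measurable_psi1.
- exact: psi11_ge0.
- exact: psi11_le_psi1.
Qed.

(** If E psi1 (|X| / x) <= 1, then |X| <= x psi1 (|X| / x) dominates X by an
    integrable function. *)
Lemma sub_exponential_integrable X : sub_exponential P X ->
  P.-integrable setT (EFin \o X).
Proof.
case/ereal_inf_lt => _ [x [x0 Ex] <-] _.
have mX : measurable_fun setT (EFin \o X) by exact/measurable_EFinP.
apply/integrableP; split => //.
have xP : ('E_P[fun w => (x * psi1 (`|X w| / x))%R] < +oo)%E.
  rewrite unlock; under eq_integral do rewrite EFinM.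
  rewrite ge0_integralZl_EFin//.
  - have := Ex; rewrite unlock => Ex1.
    rewrite (le_lt_trans (lee_wpmul2l _ Ex1)) ?lee_fin ?(ltW x0)//.
    by rewrite mule1 ltry.
  - by move=> w _; rewrite lee_fin (le_trans _ (psi1_ge _))// divr_ge0// ltW.
  - by apply/measurable_EFinP/measurable_psi_scaled; exact: measurable_psi1.
  - exact: ltW.
apply: le_lt_trans xP; rewrite unlock; apply: ge0_le_integral => //.
- by apply: measurableT_comp.
- apply/measurable_EFinP; apply: measurable_funM => //.
  by apply: measurable_psi_scaled; exact: measurable_psi1.
- move=> w _; rewrite /= lee_fin -ler_pdivrMl// mulrC; exact: psi1_ge.
Qed.

(** As psi11 is nondecreasing, the scales admissible in the infimum form an
    up-set, so it contains every c strictly above the norm; stating the bound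
    for such c treats variables of norm zero together with the others. *)
Lemma psi11_norm_lt_expectation X c : (psi_norm P (@psi11 R) X < c%:E)%E ->
  0 < c /\ ('E_P[fun w => psi11 (`|X w| / c)] <= 1)%E.
Proof.
case/ereal_inf_lt => _ [x [x0 Ex] <-]; rewrite lte_fin => xc.
have c0 : 0 < c by exact: lt_trans xc.
split=> //; apply: le_trans Ex; apply: ge0_expectation_le => [||w|w].
- by apply: measurable_psi_scaled; exact: measurable_psi11.
- by apply: measurable_psi_scaled; exact: measurable_psi11.
- exact: psi11_ge0.
- apply: le_psi11; first by rewrite divr_ge0// ltW.
  by rewrite ler_wpM2l// lef_pV2 ?posrE// ltW.
Qed.

(** Subtracting the mean removes the linear term of the exponential:
    E exp (t X) = 1 + E psi11 (t X) <= 1 + (t c) ^ 2 E psi11 (|X| / c)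
    <= 1 + (t c) ^ 2. *)
Lemma expectation_expR_le X t c : ('E_P[X] = 0)%E ->
  P.-integrable setT (EFin \o X) ->
  (psi_norm P (@psi11 R) X < c%:E)%E -> 0 <= t -> t * c <= 1 ->
  ('E_P[fun w => expR (t * X w)] <= (expR ((t * c) ^+ 2))%:E)%E.
Proof.
move=> EX iX /psi11_norm_lt_expectation[c0 Ec] t0 tc.
pose r w : R := psi11 (`|X w| / c).
have r0 w : 0 <= r w by exact: psi11_ge0.
have mr : measurable_fun setT (EFin \o r).
  by apply/measurable_EFinP/measurable_psi_scaled; exact: measurable_psi11.
have ir : P.-integrable setT (EFin \o r).
  apply/integrableP; split => //.
  rewrite (_ : (fun x => _) = EFin \o r); last first.
    by apply/funext => w /=; rewrite ger0_norm.
  by have := Ec; rewrite unlock => /le_lt_trans; apply; exact: ltry.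
have mX : measurable_fun setT (fun w => t * X w) by exact: measurable_funM.
have le1 : ('E_P[fun w => expR (t * X w)] <=
    \int[P]_w ((cst 1 w + t%:E * (X w)%:E) + ((t * c) ^+ 2)%:E * (r w)%:E))%E.
  rewrite unlock; apply: ge0_le_integral => //.
  - by apply/measurable_EFinP; exact: measurableT_comp.
  - apply: emeasurable_funD; last by apply: measurable_funeM.
    by apply: emeasurable_funD => //; apply: measurable_funeM; exact/measurable_EFinP.
  - move=> w _; rewrite -!EFinM -!EFinD lee_fin.
    have := @psi11_scale_le R t c (X w) t0 c0 tc; rewrite -/(r w) /psi11; lra.
apply: (le_trans le1).
have i1 : P.-integrable setT (cst (1%:E : \bar R)) by exact: finite_measure_integrable_cst.
have itX : P.-integrable setT (fun w => t%:E * (X w)%:E)%E by exact: integrableZl.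
have itr : P.-integrable setT (fun w => ((t * c) ^+ 2)%:E * (r w)%:E)%E by exact: integrableZl.
rewrite integralD//; last exact: integrableD.
have -> : (\int[P]_w (cst 1 w + t%:E * (X w)%:E) = 1)%E.
  rewrite integralD// integral_cst//= probability_setT mule1 integralZl//.
  by have := EX; rewrite unlock => ->; rewrite mule0 adde0.
rewrite integralZl//.
apply: (@le_trans _ _ (1 + ((t * c) ^+ 2)%:E * 1)%E).
  apply: leeD2l; apply: lee_wpmul2l; first by rewrite lee_fin sqr_ge0.
  by have := Ec; rewrite unlock.
by rewrite mule1 -EFinD lee_fin expR_ge1Dx.
Qed.

End mgf.

(** * Exponential moments and tails of the sum *)

Section sums.
Context d (T : measurableType d) (R : realType) (P : probability T R).

(** The bound holds for every scale c above a with t c <= 1; let c decrease to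
    a. *)
Lemma mgf_le (X : {RV P >-> R}) (t a : R) : ('E_P[X] = 0)%E ->
  P.-integrable setT (EFin \o X) ->
  psi_norm P (@psi11 R) X = a%:E -> 0 <= t -> t * a < 1 ->
  ('E_P[fun w => expR (t * X w)] <= (expR (t ^+ 2 * a ^+ 2))%:E)%E.
Proof.
move=> EX iX Xa t0 ta.
have bnd c : a < c -> t * c <= 1 ->
    ('E_P[fun w => expR (t * X w)] <= (expR ((t * c) ^+ 2))%:E)%E.
  by move=> ac tc; apply: expectation_expR_le => //; rewrite Xa lte_fin.
have tc : \forall c \near a^'+, a < c /\ t * c <= 1.
  near=> c; split; first by near: c; exact: nbhs_right_gt.
  near: c; apply: (@cvgr_le _ _ _ _ (fun c => t * c) (t * a)) => //.
  by apply: cvgM; [exact: cvg_cst|exact: cvg_at_right_filter].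
have [c [ac tc1]] := @filter_ex _ _ _ _ tc.
have Efin : ('E_P[fun w => expR (t * X w)])%E \is a fin_num.
  rewrite ge0_fin_numE; first exact: le_lt_trans (bnd c ac tc1) (ltry _).
  by apply: expectation_ge0 => w; exact: expR_ge0.
rewrite -(fineK Efin) lee_fin -exprMn.
apply: (@cvgr_to_ge _ (a^'+) _ _ (fun c => expR ((t * c) ^+ 2))).
  apply: cvg_at_right_filter.
  apply: (@continuous_cvg _ _ _ _ _ _ expR); first exact: continuous_expR.
  by apply: cvgM; apply: cvgM => //; exact: cvg_cst.
by apply: filterS tc => c' [ac' tc']; rewrite -lee_fin fineK// bnd.
Unshelve. all: by end_near. Qed.

Context (n : nat) (X : 'I_n -> {RV P >-> R}) (a : 'I_n -> R).
Hypothesis Xindep : mutually_independent P X.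
Hypothesis Xmean : forall i, ('E_P[X i] = 0)%E.
Hypothesis Xint : forall i, P.-integrable setT (EFin \o X i).
Hypothesis Xa : forall i, psi_norm P (@psi11 R) (X i) = (a i)%:E.

Lemma mgf_sum_le (t : R) : 0 <= t -> (forall i, t * a i < 1) ->
  ('E_P[fun w => expR (t * \sum_i X i w)] <=
    (expR (t ^+ 2 * \sum_i a i ^+ 2))%:E)%E.
Proof.
move=> t0 ta.
have Ei i := mgf_le (Xmean i) (Xint i) (Xa i) t0 (ta i).
have E0 i : (0 <= 'E_P[fun w => expR (t * X i w)])%E.
  by apply: expectation_ge0 => w; exact: expR_ge0.
have Efin i : ('E_P[fun w => expR (t * X i w)])%E \is a fin_num.
  by rewrite ge0_fin_numE//; exact: le_lt_trans (Ei i) (ltry _).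
rewrite mulr_sumr expR_sum.
under eq_fun do rewrite mulr_sumr expR_sum.
rewrite (@expectation_prod_independent _ _ _ _ _ P _ X (fun _ y => expR (t * y)))//.
- rewrite (eq_bigr _ (fun i _ => esym (fineK (Efin i)))) prodEFin lee_fin.
  apply: ler_prod => i _; rewrite fine_ge0 ?E0//=.
  by rewrite -lee_fin fineK.
- by move=> i; apply: measurableT_comp => //; exact: measurable_funM.
- by move=> i; have := Efin i; rewrite ge0_fin_numE.
Qed.

(** Markov's inequality for exp (s S) gives the bound for every s < t; the end
    point t = 1 / m, not covered by mgf_sum_le, is reached by letting s increase
    to t. *)
Lemma tail_le (x t m : R) : 0 < m -> (forall i, a i <= m) ->
  0 <= t -> t * m <= 1 ->
  (P [set w | (x <= \sum_i X i w)%R] <=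
    (expR (t ^+ 2 * \sum_i a i ^+ 2 - t * x))%:E)%E.
Proof.
move=> m0 am t0 tm; set b := \sum_i a i ^+ 2.
pose S := fun w => \sum_i X i w.
have mS : measurable_fun setT S by exact: measurable_sum.
have [->|tN0] := eqVneq t 0.
  rewrite expr0n/= !mul0r subr0 expR0; apply: probability_le1.
  rewrite (_ : [set w | _] = S @^-1` `[x, +oo[); last first.
    by apply/seteqP; split=> w /=; rewrite in_itv /= andbT.
  by rewrite -[X in measurable X]setTI; exact: mS.
have {tN0} t_gt0 : 0 < t by rewrite lt_neqAle eq_sym tN0.
pose S' : {RV P >-> R} := HB.pack S (isMeasurableFun.Build _ _ _ _ S mS).
have bnd s : 0 < s -> s < t ->
    (P [set w | (x <= S w)%R] <= (expR (s ^+ 2 * b - s * x))%:E)%E.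
  move=> s0 st; have := @chernoff _ _ _ P S' s x s0.
  move=> /le_trans; apply; rewrite expRD EFinM.
  rewrite lee_wpmul2r ?lee_fin ?expR_ge0//.
  rewrite /mmt_gen_fun (_ : expR \o s \o* S' = fun w => expR (s * S w)).
    apply: mgf_sum_le => [|i]; first exact: ltW.
    by rewrite (@le_lt_trans _ _ (s * m)) ?ler_pM2l// (lt_le_trans _ tm)// ltr_pM2r.
  by apply/funext => w /=; rewrite mulrC.
have Pfin : P [set w | (x <= S w)%R] \is a fin_num.
  rewrite ge0_fin_numE// (le_lt_trans _ (ltry (expR ((t / 2) ^+ 2 * b - t / 2 * x))))//.
  by apply: bnd; lra.
rewrite -(fineK Pfin) lee_fin.
apply: (@cvgr_to_ge _ (t^'-) _ _ (fun s => expR (s ^+ 2 * b - s * x))).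
  apply: cvg_at_left_filter.
  apply: (@continuous_cvg _ _ _ _ _ _ expR); first exact: continuous_expR.
  apply: cvgB; apply: cvgM; [apply: cvgM|exact: cvg_cst| |exact: cvg_cst];
    exact: cvg_id.
near=> s; rewrite -lee_fin fineK//; apply: bnd; near: s.
- exact: nbhs_left_gt.
- exact: nbhs_left_lt.
Unshelve. all: by end_near. Qed.

End sums.

(** * The norms of a finite family *)

Section norms_of_a_family.
Context d (T : measurableType d) (R : realType) (P : probability T R).
Context (f : R -> R) (n : nat) (X : 'I_n -> T -> R) (a : 'I_n -> R).
Hypothesis Xa : forall i, psi_norm P f (X i) = (a i)%:E.

Lemma sum_sqr_normE : sum_sqr_norm P f X = (\sum_i a i ^+ 2)%:E.
Proof.
rewrite /sum_sqr_norm -sumEFin; apply: eq_bigr => i _.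
by rewrite Xa.
Qed.

Lemma le_max_norm i : ((a i)%:E <= max_norm P f X)%E.
Proof. by rewrite -Xa; apply: le_bigmax. Qed.

Lemma max_norm_lty : (max_norm P f X < +oo)%E.
Proof. by apply: bigmax_lt => // i _; rewrite Xa ltry. Qed.

Lemma max_norm_gt0 : (0 < max_norm P f X)%E <-> exists i, 0 < a i.
Proof.
split=> [M0|[i ai]]; last by apply: lt_le_trans (le_max_norm i); rewrite lte_fin.
apply/not_existsP => H; move: M0; apply/negP; rewrite -leNgt.
by apply: bigmax_le => // i _; rewrite Xa lee_fin leNgt; apply/negP/H.
Qed.

Lemma sum_sqr_norm_gt0 : (forall i, 0 <= a i) ->
  (0 < sum_sqr_norm P f X)%E <-> exists i, 0 < a i.
Proof.
move=> a0; rewrite sum_sqr_normE lte_fin; split=> [B0|[i ai]].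
  apply/not_existsP => H; move: B0; rewrite big1 ?ltxx// => i _.
  have /eqP-> : a i == 0 by rewrite eq_le a0 leNgt andbT; apply/negP/H.
  by rewrite expr0n.
rewrite (bigD1 i)//= ltr_pwDl ?exprn_gt0// sumr_ge0// => j _; exact: sqr_ge0.
Qed.

End norms_of_a_family.

(** * The exponential tail bounds *)

Theorem theorem2 (d : measure_display) (T : measurableType d) (R : realType)
    (P : probability T R) (n : nat) (X : 'I_n -> {RV P >-> R})
    (Xindep : mutually_independent P X)
    (Xmean : forall i : 'I_n, ('E_P[X i] = 0)%E)
    (Xsub : forall i : 'I_n, sub_exponential P (X i)) :
  let S := fun w : T => \sum_(i < n) X i w in
  let B1 := sum_sqr_norm P (@psi11 R) (fun i => X i) in
  let M1 := max_norm P (@psi11 R) (fun i => X i) in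
  let B := sum_sqr_norm P (@psi1 R) (fun i => X i) in
  let M := max_norm P (@psi1 R) (fun i => X i) in
  ((0 < M1 < +oo)%E <-> (0 < B1 < +oo)%E) /\
  ((0 < M1 < +oo)%E ->
    (B1 <= B < +oo)%E /\ (M1 <= M < +oo)%E /\
    forall x : R, 0 <= x ->
      [/\ (P [set w | (x <= S w)%R] <= (boundU x (fine B1) (fine M1))%:E)%E
        & boundU x (fine B1) (fine M1) <= bound_min x (fine B1) (fine M1)] /\
      [/\ (P [set w | (x <= S w)%R] <= (boundU x (fine B) (fine M))%:E)%E
        & boundU x (fine B) (fine M) <= bound_min x (fine B) (fine M)] /\
      [/\ boundU x (fine B1) (fine M1) <= boundU x (fine B) (fine M)
        & bound_min x (fine B1) (fine M1) <= bound_min x (fine B) (fine M)]).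
Proof.
move=> S B1 M1 B M.
pose a1 i := fine (psi_norm P (@psi11 R) (X i)).
pose a i := fine (psi_norm P (@psi1 R) (X i)).
have Xa i : psi_norm P (@psi1 R) (X i) = (a i)%:E.
  by rewrite fineK// ge0_fin_numE ?psi_norm_ge0//; exact: Xsub.
have Xa1 i : psi_norm P (@psi11 R) (X i) = (a1 i)%:E.
  rewrite fineK// ge0_fin_numE ?psi_norm_ge0//.
  exact: le_lt_trans (psi11_norm_le_psi1_norm (X i)) (Xsub i).
have a1_ge0 i : 0 <= a1 i by rewrite fine_ge0// psi_norm_ge0.
have a1_le i : a1 i <= a i by rewrite -lee_fin -Xa -Xa1 psi11_norm_le_psi1_norm.
have B1E : B1 = (\sum_i a1 i ^+ 2)%:E by exact: sum_sqr_normE.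
have BE : B = (\sum_i a i ^+ 2)%:E by exact: sum_sqr_normE.
have M1oo : (M1 < +oo)%E by exact: max_norm_lty Xa1.
have Moo : (M < +oo)%E by exact: max_norm_lty Xa.
have M1B1 : (0 < M1)%E <-> (0 < B1)%E.
  exact: iff_trans (max_norm_gt0 Xa1) (iff_sym (sum_sqr_norm_gt0 Xa1 a1_ge0)).
split; first by rewrite M1oo {2}B1E ltry !andbT.
rewrite M1oo andbT => M1_gt0; have /M1B1 B1_gt0 := M1_gt0.
have B1B : (B1 <= B)%E.
  rewrite B1E BE lee_fin; apply: ler_sum => i _.
  by rewrite lerXn2r// nnegrE// (le_trans (a1_ge0 i)).
have M1M : (M1 <= M)%E.
  by apply: le_bigmax2 => i _; exact: psi11_norm_le_psi1_norm.
split; first by rewrite B1B BE ltry.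
split; first by rewrite M1M.
have M1fin : M1 \is a fin_num by rewrite ge0_fin_numE// ltW.
have Mfin : M \is a fin_num.
  by rewrite ge0_fin_numE// (le_trans (ltW M1_gt0)).
have m1_gt0 : 0 < fine M1 by rewrite -lte_fin fineK.
have m1_le : fine M1 <= fine M by rewrite -lee_fin !fineK.
have b1_gt0 : 0 < fine B1 by rewrite -lte_fin fineK// B1E.
have b1_le : fine B1 <= fine B by move: B1B; rewrite B1E BE lee_fin.
have m_gt0 := lt_le_trans m1_gt0 m1_le.
have b_gt0 := lt_le_trans b1_gt0 b1_le.
move=> x x0.
have UU : boundU x (fine B1) (fine M1) <= boundU x (fine B) (fine M).
  exact: le_boundU.
have PU : (P [set w | (x <= S w)%R] <= (boundU x (fine B1) (fine M1))%:E)%E.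
  have [t [t0 tm ->]] := boundU_attained b1_gt0 m1_gt0 x0.
  rewrite B1E; apply: (@tail_le _ _ _ _ _ X a1 _ _ _ _ x t (fine M1)) => //.
    by move=> i; exact: sub_exponential_integrable.
  by move=> i; rewrite -lee_fin (fineK M1fin); exact: (le_max_norm Xa1).
split; first by split=> //; exact: boundU_le_min.
split; last by split=> //; exact: le_bound_min.
split; last exact: boundU_le_min.
by apply: (le_trans PU); rewrite lee_fin.
Qed.
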